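(* Let $\boldsymbol{\beta}=(\beta_1,\dots,\beta_p)$ be an alternate base and set $\delta=\prod_{i=1}^p\beta_i$. If every rational number in $[0,1)$ has an eventually periodic $\boldsymbol{\beta}$-expansion (i.e. $\mathbb{Q}\cap[0,1)\subseteq \mathrm{Per}(\boldsymbol{\beta})$), then $\delta$ is either a Pisot number or a Salem number, and $\beta_1,\dots,\beta_p\in\mathbb{Q}(\delta)$.
   Context: An alternate base is a $p$-tuple $\boldsymbol{\beta}=(\beta_1,\dots,\beta_p)$ of real numbers $\beta_i>1$ ($p\ge 1$), identified with the purely periodic sequence $(\beta_k)_{k\ge1}$ with $\beta_{k+p}=\beta_k$. For $x\in[0,1)$ the $\boldsymbol{\beta}$-expansion $d_{\boldsymbol{\beta}}(x)=a_1a_2a_3\cdots$ is given by the greedy algorithm: $r_0=x$ and for $k\ge0$, $a_{k+1}=\lfloor \beta_{k+1}r_k\rfloor$, $r_{k+1}=\beta_{k+1}r_k-a_{k+1}$; then $x=\sum_{k\ge1} a_k/\prod_{i=1}^k\beta_i$. $\mathrm{Per}(\boldsymbol{\beta})$ denotes the set of $x\in[0,1)$ whose $\boldsymbol{\beta}$-expansion is eventually periodic. A Pisot number is a real algebraic integer $>1$ all of whose other conjugates have modulus $<1$; a Salem number is a real algebraic integer $>1$ all of whose other conjugates have modulus $\le1$, at least one having modulus exactly $1$. *)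

(* Defs.v *)
From HB Require Import structures.
From mathcomp Require Import all_boot all_order all_algebra.
From mathcomp Require Import reals complex.
Set Implicit Arguments. Unset Strict Implicit. Unset Printing Implicit Defensive.
Import Order.TTheory GRing.Theory Num.Theory.
Local Open Scope ring_scope.

Section AltBase.
Variables (R : realType) (p : nat) (beta : 'I_p.+1 -> R).

(* the purely periodic sequence (beta_k)_{k>=1}, beta_{k+p} = beta_k;
   here indexed from 1: betak k = beta_(k) for k >= 1 *)
Definition betak (k : nat) : R := beta (inord ((k.-1) %% p.+1)).

Fixpoint altrem (x : R) (k : nat) : R :=
  match k with
  | 0 => x
  | k'.+1 => betak k'.+1 * altrem x k' - (Num.floor (betak k'.+1 * altrem x k'))%:~R
  end.

(* digit a_{k} for k >= 1: a_{k+1} = floor (beta_{k+1} r_k) *)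
Definition altdigit (x : R) (k : nat) : int :=
  Num.floor (betak k * altrem x k.-1).

Definition eventually_periodic_exp (x : R) : Prop :=
  exists N T : nat, (0 < T)%N /\ forall n, (N < n)%N -> altdigit x (n + T) = altdigit x n.

End AltBase.

Section Algebraic.
Variable (R : realType).

Definition alg_int (x : R) : Prop :=
  exists q : {poly int}, q \is monic /\ root (map_poly intr q) x.

Definition conjugate (x : R) (z : R[i]) : Prop :=
  exists q : {poly rat}, [/\ q \is monic, irreducible_poly q,
     root (map_poly ratr q) x & root (map_poly ratr q) z].

Definition pisot (x : R) : Prop :=
  [/\ alg_int x, 1 < x &
      forall z : R[i], conjugate x z -> z != (x%:C)%C -> `|z| < 1].

Definition salem (x : R) : Prop :=
  [/\ alg_int x, 1 < x,
      (forall z : R[i], conjugate x z -> z != (x%:C)%C -> `|z| <= 1) &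
      exists2 z : R[i], conjugate x z /\ z != (x%:C)%C & `|z| = 1].

Definition in_Qfield (x y : R) : Prop :=
  exists f g : {poly rat}, (map_poly ratr g).[x] != 0 /\
     y = (map_poly ratr f).[x] / (map_poly ratr g).[x].

End Algebraic.

(* Main.v *)
(* Write g_i = 1 / (beta_1 ... beta_i) and group the digits of an expansion in
   blocks of length p. If the expansion of x is eventually periodic, then
     x = sum_i g_i A_i(1/delta),
   where A_i is an integer power series with bounded, eventually periodic
   coefficients, hence a rational function.
   - A rational x slightly above g_m has an expansion that starts like that of
     g_m, so A_i is close to 1 for i = m and to 0 otherwise. The resulting linear
     system for the g_i is invertible, so that all g_i lie in Q(delta).
   - For x = 1/d with d large, the expansion starts with many zeros. Clearing
     denominators gives an integer polynomial relation for delta in which the left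
     side dominates in degree, so delta is algebraic; then each g_i is a polynomial
     in delta with a common denominator D, and taking d divisible by D makes the
     relation monic.
   - The first relation is transported to any conjugate z of delta. If |z| > 1, the
     series also converge at z, and x -> 1/delta yields x -> 1/z, so z = delta. *)
Require Import Defs.
From HB Require Import structures.
From mathcomp Require Import all_boot all_order all_algebra.
From mathcomp Require Import reals complex.
From mathcomp Require Import boolp ring lra zify.
Set Implicit Arguments. Unset Strict Implicit. Unset Printing Implicit Defensive.
Import Order.TTheory GRing.Theory Num.Theory.
Local Open Scope ring_scope.

(** * Unbounded growth of powers *)

Lemma exists_expr_gt (R : archiRealFieldType) (t K : R) :
  1 < t -> exists n : nat, K < t ^+ n.
Proof.
move=> t1; have tp : 0 < t - 1 by rewrite subr_gt0.
have bern n : n%:R * (t - 1) <= t ^+ n.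
  suff : 1 + n%:R * (t - 1) <= t ^+ n by lra.
  elim: n => [|n IH]; first by rewrite mul0r addr0 expr0.
  rewrite exprS; have n0 : 0 <= n%:R :> R by rewrite ler0n.
  have := ler_wpM2l (ltW (lt_trans ltr01 t1)) IH.
  rewrite -natr1; apply: le_trans.
  have := mulr_ge0 n0 (sqr_ge0 (t - 1)); nra.
exists (Num.bound `|K / (t - 1)|); apply: lt_le_trans (bern _).
by rewrite -ltr_pdivrMr // (le_lt_trans (ler_norm _)) // archi_boundP.
Qed.

Lemma expr_mul_bounded_eq0 (R : archiRealFieldType) (t a K : R) :
  1 < t -> 0 <= a -> (forall n, a * t ^+ n <= K) -> a = 0.
Proof.
move=> t1 a0 bd; apply/eqP; rewrite eq_le a0 andbT leNgt; apply/negP => ap.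
have [n] := exists_expr_gt (K / a) t1.
by rewrite ltr_pdivrMr // mulrC ltNge bd.
Qed.

(** * Greedy expansions in an alternate base *)

Section Expansion.
Variables (R : realType) (p : nat) (beta : 'I_p.+1 -> R).
Hypothesis beta_gt1 : forall i, 1 < beta i.

Local Notation rem := (altrem beta).
Local Notation dig := (altdigit beta).
Local Notation delta := (\prod_(i < p.+1) beta i).

Definition base_prod (n : nat) : R := \prod_(l < n) betak beta l.+1.
Local Notation B := base_prod.

Lemma betak_gt1 k : 1 < betak beta k.
Proof. exact: beta_gt1. Qed.

Lemma betak_gt0 k : 0 < betak beta k.
Proof. exact: lt_trans ltr01 (betak_gt1 k). Qed.

Lemma betak_shift j k : betak beta (j * p.+1 + k.+1) = betak beta k.+1.
Proof. by rewrite /betak addnS /= modnMDl. Qed.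

Lemma base_prodS n : B n.+1 = betak beta n.+1 * B n.
Proof. by rewrite /base_prod big_ord_recr mulrC. Qed.

Lemma base_prod0 : B 0 = 1.
Proof. by rewrite /base_prod big_ord0. Qed.

Lemma base_prod_gt0 n : 0 < B n.
Proof. by apply: prodr_gt0 => i _; apply: betak_gt0. Qed.

Lemma base_prod_lt : {homo B : m n / (m < n)%N >-> m < n}.
Proof.
apply: homo_ltn => [|n]; first exact: lt_trans.
by rewrite base_prodS ltr_pMl ?base_prod_gt0 ?betak_gt1.
Qed.

Lemma base_prod_period : B p.+1 = delta.
Proof.
apply: eq_bigr => i _; rewrite /betak /=; congr beta.
by apply: val_inj; rewrite /= modn_small // inordK.
Qed.

Lemma delta_gt1 : 1 < delta.
Proof. by rewrite -base_prod_period -base_prod0 base_prod_lt. Qed.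

Lemma altremS x k : rem x k.+1 = betak beta k.+1 * rem x k - (dig x k.+1)%:~R.
Proof. by []. Qed.

Lemma altrem_itv x k : 0 <= x < 1 -> 0 <= rem x k < 1.
Proof.
move=> x01; case: k => [//|k]; rewrite altremS /altdigit /=.
have := floor_itv (betak beta k.+1 * rem x k).
by rewrite intrD; set f := _%:~R; lra.
Qed.

(** Each base is at most [delta], the other factors exceeding 1, and remainders stay below 1. One
    [C] serves all [x]. *)
Lemma altdigit_bounded :
  exists C : nat, forall x k, 0 <= x < 1 -> `|dig x k.+1| <= C%:Z.
Proof.
have d0 : 0 <= delta by rewrite ltW // (lt_trans ltr01) ?delta_gt1.
exists (Num.bound delta) => x k x01.
have /andP[r0 r1] := altrem_itv k x01.
have b1 := betak_gt1 k.+1.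
have bd : betak beta k.+1 <= delta.
  rewrite (bigD1 (inord (k %% p.+1))) //= ler_peMr ?(ltW (betak_gt0 _)) //.
  apply: (big_ind (fun x => 1 <= x)) => // [u v|i _]; last exact: ltW.
  exact: mulr_ege1.
have f0 : 0 <= dig x k.+1.
  by rewrite /altdigit floor_ge0 mulr_ge0 // ltW // betak_gt0.
rewrite ger0_norm // -(ler_int R) /altdigit (le_trans (floor_le _)) //=.
apply: le_trans (ltW (archi_boundP d0)); apply: le_trans bd.
nra.
Qed.

(** Unrolls the recursion from a block boundary, where the products of bases restart by
    periodicity. *)
Lemma altrem_block x j i :
  rem x (j * p.+1 + i) =
  B i * (rem x (j * p.+1) - \sum_(l < i) (dig x (j * p.+1 + l).+1)%:~R / B l.+1).
Proof.
elim: i => [|i IH]; first by rewrite addn0 base_prod0 big_ord0 subr0 mul1r.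
rewrite addnS altremS IH -addnS betak_shift big_ord_recr /= base_prodS addnS.
field; have := base_prod_gt0 i; have := betak_gt0 i.+1.
by move=> /lt0r_neq0 -> /lt0r_neq0 ->.
Qed.

Lemma floor_right_const (y : R) : exists2 eta : R, 0 < eta &
  forall z, 0 <= z < eta -> Num.floor (y + z) = Num.floor y.
Proof.
have := floor_itv y; rewrite intrD => fy.
exists ((Num.floor y)%:~R + 1 - y) => [|z zb]; first by lra.
by apply: floor_def; rewrite intrD; lra.
Qed.

(** Right continuity of the floor: an increase [y] reaches step [k] magnified by [B k] and, if small
    enough, crosses no integer. *)
Lemma altdigit_right_const x k : exists2 eta : R, 0 < eta &
  forall y, 0 <= y < eta ->
    rem (x + y) k = rem x k + B k * y /\
    forall l, (l < k)%N -> dig (x + y) l.+1 = dig x l.+1.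
Proof.
elim: k => [|k [eta eta0 IH]].
  by exists 1 => // y _; rewrite base_prod0 mul1r.
have [e e0 he] := floor_right_const (betak beta k.+1 * rem x k).
have Bp := base_prod_gt0 k.+1.
exists (Num.min eta (e / B k.+1)).
  by rewrite lt_min eta0 divr_gt0.
move=> y /andP[y0]; rewrite lt_min => /andP[y1 y2].
have [|rE dE] := IH y; first by rewrite y0.
have bE : betak beta k.+1 * rem (x + y) k = betak beta k.+1 * rem x k + B k.+1 * y.
  by rewrite rE base_prodS mulrDr mulrA.
have fE : dig (x + y) k.+1 = dig x k.+1.
  rewrite /altdigit /= bE he // mulr_ge0 ?(ltW Bp) //=.
  by rewrite mulrC -ltr_pdivlMr.
split; first by rewrite !altremS fE bE addrAC.
move=> l; rewrite ltnS leq_eqVlt => /orP[/eqP -> //|]; exact: dE.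
Qed.

(* [weight i] is the value of a digit 1 in position [i + 1]. *)
Definition weight (i : nat) : R := (B i.+1)^-1.

Lemma weight_gt0 i : 0 < weight i.
Proof. by rewrite invr_gt0 base_prod_gt0. Qed.

Lemma weight_lt1 i : weight i < 1.
Proof. by rewrite invf_lt1 ?base_prod_gt0 // -base_prod0 base_prod_lt. Qed.

(** The remainder grows with zero digits up to step [m]; there its product with the next base is
    exactly 1, and the digit 1 leaves nothing. *)
Lemma altrem_weight m k :
  rem (weight m) k = if (k <= m)%N then B k * weight m else 0.
Proof.
elim: k => [|k IH]; first by rewrite base_prod0 mul1r.
have Bm := base_prod_gt0 m.+1.
rewrite altremS /altdigit /= IH.
case: (ltngtP k m) => km; last 1 first.
- rewrite km mulrA -base_prodS /weight mulfV ?(lt0r_neq0 Bm) // floor1 subrr //.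
- rewrite mulrA -base_prodS.
  rewrite [Num.floor _](_ : _ = 0) ?subr0 //; apply: floor_def.
  rewrite add0r mulr_ge0 ?(ltW (base_prod_gt0 _)) ?(ltW (weight_gt0 _)) //=.
  by rewrite ltr_pdivrMr // mul1r base_prod_lt.
- by rewrite mulr0 floor0 subrr.
Qed.

Lemma altdigit_weight m k : dig (weight m) k.+1 = (k == m).
Proof.
have Bm := base_prod_gt0 m.+1.
apply: (@intr_inj R).
have := altremS (weight m) k; rewrite !altrem_weight.
case: (ltngtP k m) => km; rewrite ?ltnn ?km ?(ltnW km) ?leqnn; last 1 first.
- by rewrite mulrA -base_prodS /weight mulfV ?(lt0r_neq0 Bm) //=; lra.
- by rewrite mulrA -base_prodS /=; lra.
- by rewrite mulr0 /=; lra.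
Qed.

Lemma altrem0 k : rem 0 k = 0.
Proof. by elim: k => //= k ->; rewrite mulr0 floor0 subrr. Qed.

Lemma altdigit0 k : dig 0 k = 0.
Proof. by rewrite /altdigit altrem0 mulr0 floor0. Qed.

(* Positions are grouped in blocks of length [p.+1]: block [j], offset [i]. *)
Definition blockdigit (x : R) (i j : nat) : int := dig x (j * p.+1 + i).+1.

Lemma altrem_blockS x j :
  rem x (j.+1 * p.+1) =
  delta * (rem x (j * p.+1) - \sum_(i < p.+1) (blockdigit x i j)%:~R * weight i).
Proof. by rewrite mulSn addnC altrem_block base_prod_period. Qed.

(* Digits determine the remainder, because the difference of two remainders
   with the same digits is multiplied by [delta] at every block. *)
Lemma altrem_periodic x : 0 <= x < 1 -> eventually_periodic_exp beta x ->
  exists N0 T, (0 < T)%N /\ forall N, (N0 <= N)%N ->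
    rem x ((N + T) * p.+1) = rem x (N * p.+1).
Proof.
move=> x01 [N0 [T [T0 per]]]; exists N0, T; split=> // N hN.
have per' k n : (N0 < n)%N -> dig x (n + k * T) = dig x n.
  move=> hn; elim: k => [|k IH]; first by rewrite addn0.
  by rewrite mulSn [(T + _)%N]addnC addnA per ?IH // ltn_addr.
(* A shift by [T] blocks moves digits by [p.+1 * T], a multiple of the period [T]. *)
have perb i j : (N0 <= j)%N -> blockdigit x i (j + T) = blockdigit x i j.
  move=> hj; rewrite /blockdigit mulnDl (_ : (_ + _).+1 = (j * p.+1 + i).+1 + p.+1 * T)%N; last by lia.
  by rewrite per' //; nia.
pose D j := rem x ((N + j + T) * p.+1) - rem x ((N + j) * p.+1).
have DE j : D j = D 0%N * delta ^+ j.
  elim: j => [|j IH]; first by rewrite mulr1.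
  rewrite exprS mulrCA -IH /D !addnS !addSn !altrem_blockS.
  have -> : \sum_(i < p.+1) (blockdigit x i (N + j + T))%:~R * weight i =
            \sum_(i < p.+1) (blockdigit x i (N + j))%:~R * weight i.
    by apply: eq_bigr => i _; rewrite perb // (leq_trans hN) // leq_addr.
  by rewrite -mulrBr; congr (_ * _); ring.
have : `|D 0%N| = 0.
  apply: (expr_mul_bounded_eq0 (K := 1) delta_gt1) => // j.
  have d0 : 0 <= delta ^+ j by rewrite exprn_ge0 // ltW // (lt_trans ltr01) // delta_gt1.
  rewrite -[delta ^+ j]ger0_norm // -normrM -DE /D.
  have := altrem_itv ((N + j + T) * p.+1) x01; have := altrem_itv ((N + j) * p.+1) x01.
  by rewrite ler_norml; lra.
by move/eqP; rewrite normr_eq0 /D addn0 subr_eq0 => /eqP.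
Qed.

End Expansion.

(** * Evaluation of integer polynomials, and conjugates *)

Section Evaluation.
Variables (K : comNzRingType) (z : K).

Definition ev (q : {poly int}) : K := (map_poly intr q).[z].

HB.instance Definition _ := GRing.RMorphism.copy ev (horner_eval z \o map_poly intr).

Lemma evC (c : int) : ev c%:P = c%:~R.
Proof. by rewrite /ev map_polyC hornerC. Qed.

Lemma evX : ev 'X = z.
Proof. by rewrite /ev map_polyX hornerX. Qed.

Lemma evXn n : ev 'X^n = z ^+ n.
Proof. by rewrite rmorphXn /= evX. Qed.

End Evaluation.

Lemma ev_map_ratr (K : numFieldType) (z : K) (q : {poly int}) :
  (map_poly ratr (map_poly intr q)).[z] = ev z q.
Proof.
rewrite -map_poly_comp /ev; congr (_.[z]); apply: eq_map_poly => c.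
exact: ratr_int.
Qed.

(** The irreducible [m] behind the conjugacy divides [q]; otherwise a Bezout identity evaluated at
    [x] would give 0 = 1. *)
Lemma conjugate_ev0 (R : realType) (x : R) (z : R[i]) q :
  conjugate x z -> ev x q = 0 -> ev z q = 0.
Proof.
move=> [m [_ irr /rootP md /rootP mz]] qd.
pose Q := map_poly intr q : {poly rat}.
case: (boolP (m %| Q)) => [mQ|]; last first.
  rewrite -irreducible_poly_coprime // => /Bezout_eq1_coprimepP [[u v] /= uv].
  have := congr1 (fun r => (map_poly ratr r).[x]) uv.
  rewrite rmorphD !rmorphM /= !hornerE md ev_map_ratr qd !mulr0 addr0 rmorph1 hornerC.
  by move/esym/eqP; rewrite oner_eq0.
have /dvdpP [s sE] := mQ.
by rewrite -ev_map_ratr -/Q sE rmorphM /= hornerM mz mulr0.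
Qed.

(** * Digit polynomials and degree bounds *)

Lemma size_sum_mul_lt (K : nzSemiRingType) n (h V : 'I_n.+1 -> {poly K}) m e :
  (forall i, (size (V i) + e < m)%N) -> (forall i, (size (h i) <= e)%N) ->
  (size (\sum_i h i * V i)%R < m)%N.
Proof.
move=> hV hh; have m0 : (0 < m)%N by apply: leq_ltn_trans (hV ord0).
apply: (big_ind (fun q : {poly K} => (size q < m)%N)) => [|u v su sv|i _].
- by rewrite size_poly0.
- by rewrite (leq_ltn_trans (size_polyD _ _)) // gtn_max su.
- have := hV i; have := hh i; have := size_polyMleq (h i) (V i); lia.
Qed.

(* [block_poly c n] is the sum of the [c j X^(n - j)] over [j < n]. *)
Fixpoint block_poly (c : nat -> int) (n : nat) : {poly int} :=
  if n is m.+1 then (block_poly c m + (c m)%:P) * 'X else 0.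

Lemma size_block_poly (c : nat -> int) n0 n :
  (forall j, (j < n0)%N -> c j = 0) -> (size (block_poly c n) <= (n - n0).+1)%N.
Proof.
move=> c0.
have z0 m : (m <= n0)%N -> block_poly c m = 0.
  by elim: m => //= m IH mn; rewrite IH ?(ltnW mn) // c0 // addr0 mul0r.
elim: n => [|n IH]; first by rewrite size_poly0.
case: (ltnP n n0) => hn; first by rewrite z0 // size_poly0.
rewrite /= (leq_trans (size_polyMleq _ _)) // size_polyX addn2 /=.
rewrite subSn // ltnS (leq_trans (size_polyD _ _)) // geq_max IH /=.
by rewrite (leq_trans (size_polyC_leq1 _)).
Qed.

(** If [c] has period [T] from index [N] on, dividing by [period_den N T] gives the series of the
    [c j X^(-j)]: the tails cancel. *)
Definition period_poly (c : nat -> int) (N T : nat) : {poly int} :=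
  block_poly c (N + T) - block_poly c N.

Lemma size_period_poly (c : nat -> int) n0 N T :
  (forall j, (j < n0)%N -> c j = 0) ->
  (size (period_poly c N T) <= (N + T - n0).+1)%N.
Proof.
move=> c0; rewrite (leq_trans (size_polyD _ _)) // size_polyN geq_max.
rewrite size_block_poly //= (leq_trans (size_block_poly N c0)) //.
by rewrite ltnS leq_sub2r // leq_addr.
Qed.

Definition period_den (N T : nat) : {poly int} := 'X^(N + T) - 'X^N.

(** * Estimates outside the unit disc *)

Section Bounds.
Variables (K : numFieldType) (z : K) (c : nat -> int) (C n0 : nat).
Hypothesis z_gt1 : 1 < `|z|.
Hypothesis c_le : forall j, `|c j| <= C%:Z.
Hypothesis c_eq0 : forall j, (0 < j < n0)%N -> c j = 0.
Hypothesis n0_gt0 : (0 < n0)%N.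

(** Beyond index 0 only indices from [n0] on contribute, a geometric sum in [|z|]; the denominators
    of its bound are multiplied out. *)
Lemma ev_block_poly_near n : (0 < n)%N ->
  `|ev z (block_poly c n) - (c 0%N)%:~R * z ^+ n| * (`|z| - 1) * `|z| ^+ n0
    <= C%:R * `|z| * `|z| ^+ n.
Proof.
set t := `|z|; have t0 : 0 <= t by exact: normr_ge0.
have t1 : 0 < t - 1 by rewrite subr_gt0.
have C0 : 0 <= C%:R :> K by rewrite ler0n.
have step m : ev z (block_poly c m.+1) - (c 0%N)%:~R * z ^+ m.+1 =
    (ev z (block_poly c m) - (c 0%N)%:~R * z ^+ m + (c m)%:~R) * z.
  by rewrite /= rmorphM rmorphD /= evX evC exprS; ring.
have small m : (m < n0)%N -> ev z (block_poly c m.+1) - (c 0%N)%:~R * z ^+ m.+1 = 0.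
  elim: m => [|m IH] hm; first by rewrite step /= rmorph0; ring.
  by rewrite step IH ?(ltnW hm) // c_eq0 // add0r mul0r.
(* Subtracting [t] keeps the exact geometric sum, so the induction closes. *)
have big m : `|ev z (block_poly c (n0 + m)) - (c 0%N)%:~R * z ^+ (n0 + m)| * (t - 1)
    <= C%:R * (t ^+ m.+1 - t).
  elim: m => [|m IH].
    by rewrite addn0 -(prednK n0_gt0) small ?prednK // normr0 mul0r expr1 subrr mulr0.
  rewrite addnS step normrM -/t.
  have cle : `|(c (n0 + m)%N)%:~R : K| <= C%:R by rewrite -intr_norm -[C%:R]/(C%:Z%:~R) ler_int.
  set u := _ - _ in IH *.
  apply: (@le_trans _ _ ((`|u| + C%:R) * t * (t - 1))).
    rewrite !ler_wpM2r ?(ltW t1) // (le_trans (ler_normD _ _)) // lerD2l //.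
  rewrite mulrAC mulrDl.
  apply: (@le_trans _ _ ((C%:R * (t ^+ m.+1 - t) + C%:R * (t - 1)) * t)).
    by rewrite ler_wpM2r // lerD2r.
  by rewrite (exprS t m.+1) le_eqVlt; apply/orP; left; apply/eqP; ring.
move=> npos; case: (ltnP n n0) => hn.
  case: n npos hn => // n _ hn; rewrite small 1?ltnW // normr0 !mul0r.
  by rewrite !mulr_ge0 // exprn_ge0.
have := big (n - n0)%N; rewrite subnKC // => bn.
apply: (@le_trans _ _ (C%:R * t ^+ (n - n0).+1 * t ^+ n0)).
  rewrite ler_wpM2r ?exprn_ge0 // (le_trans bn) // ler_wpM2l //.
  by rewrite gerBl.
by rewrite -!mulrA -exprS -exprD addSn subnK.
Qed.

Lemma ev_period_den_neq0 N T : (0 < T)%N -> ev z (period_den N T) != 0.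
Proof.
move=> T0; have zn0 : z != 0 by rewrite -normr_gt0 (lt_trans ltr01).
rewrite rmorphB /= !evXn exprD -[X in _ - X]mulr1 -mulrBr mulf_neq0 ?expf_neq0 //.
rewrite subr_eq0; apply/eqP => zT.
by have := exprn_egt1 T z_gt1; rewrite -normrX zT normr1 ltxx -[T != _]lt0n T0.
Qed.

(** The estimates at [N + T] and [N] add up to [t^N (t^T + 1)], comparable to [t^N (t^T - 1)], which
    bounds the denominator below. The error is thus uniform in [N] and [T]. *)
Lemma ev_period_poly_near N T : (0 < N)%N -> (0 < T)%N ->
  `|ev z (period_poly c N T) - (c 0%N)%:~R * ev z (period_den N T)|
     * ((`|z| - 1) ^+ 2 * `|z| ^+ n0)
    <= C%:R * `|z| * (`|z| + 1) * `|ev z (period_den N T)|.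
Proof.
move=> N0 T0; have := ev_block_poly_near N0.
have := @ev_block_poly_near (N + T) (ltn_addr _ N0).
rewrite /period_poly /period_den !rmorphB /= !evXn.
set t := `|z|; set s := _ - _ * z ^+ (N + T); set s' := _ - _ * z ^+ N => hs hs'.
have -> : ev z (block_poly c (N + T)) - ev z (block_poly c N)
   - (c 0%N)%:~R * (z ^+ (N + T) - z ^+ N) = s - s' by rewrite /s /s'; ring.
have t0 : 0 <= t by exact: normr_ge0.
have t1 : 0 < t - 1 by rewrite subr_gt0.
have C0 : 0 <= C%:R :> K by rewrite ler0n.
have tT : t <= t ^+ T by rewrite -[X in X <= _]expr1 ler_eXn2l.
have dE : t ^+ N * (t ^+ T - 1) <= `|z ^+ (N + T) - z ^+ N|.
  by rewrite mulrBr mulr1 -exprD -!normrX; apply: lerB_dist.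
apply: (@le_trans _ _ (C%:R * t * (t ^+ N * (t ^+ T + 1)) * (t - 1))).
  rewrite (_ : _ * _ = `|s - s'| * ((t - 1) * t ^+ n0) * (t - 1)); last by ring.
  rewrite ler_wpM2r ?(ltW t1) //.
  apply: (@le_trans _ _ ((`|s| + `|s'|) * ((t - 1) * t ^+ n0))).
    by rewrite ler_wpM2r ?(mulr_ge0 (ltW t1)) ?exprn_ge0 // ler_normB.
  rewrite mulrDl !mulrA (le_trans (lerD hs hs')) // exprD.
  by rewrite le_eqVlt; apply/orP; left; apply/eqP; ring.
apply: (@le_trans _ _ (C%:R * t * (t + 1) * (t ^+ N * (t ^+ T - 1)))).
  rewrite -!mulrA ler_wpM2l // ler_wpM2l //.
  rewrite [leRHS]mulrCA ler_wpM2l ?exprn_ge0 //.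
  rewrite -subr_ge0 (_ : _ - _ = (t ^+ T - t) *+ 2); last by ring.
  by rewrite mulrn_wge0 // subr_ge0.
by rewrite ler_wpM2l // !mulr_ge0 // addr_ge0.
Qed.

End Bounds.

(** Compare sizes in the column where a null vector has its largest entry. [e m] is a dominant value
    that the diagonal entry only approximates. *)
Lemma det_neq0_diag_dominant (K : realFieldType) n (A : 'M[K]_n.+1) (e : 'I_n.+1 -> K) :
  (forall i m, `|A i m - (i == m)%:R * e m| * n.+1%:R < `|e m|) -> \det A != 0.
Proof.
move=> dom; apply/negP => /det0P [v vn0 /rowP vA].
have [m _ mmax] := arg_maxP (fun i => `|v 0 i|) (erefl : xpredT (@ord0 n)).
have {}mmax i : `|v 0 i| <= `|v 0 m| by exact: mmax.
have vm0 : 0 < `|v 0 m|.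
  rewrite lt_neqAle normr_ge0 andbT eq_sym; apply: contra vn0 => /eqP vm.
  by apply/eqP/rowP => k; rewrite mxE; apply/eqP; rewrite -normr_le0 -vm mmax.
have vE : v 0 m * e m = - \sum_i v 0 i * (A i m - (i == m)%:R * e m).
  under eq_bigr do rewrite mulrBr.
  rewrite sumrB; have := vA m; rewrite !mxE => ->.
  rewrite sub0r opprK (bigD1 m) //= eqxx mul1r big1 ?addr0 // => i /negPf ->.
  by rewrite mul0r mulr0.
have : `|v 0 m| * `|e m| * n.+1%:R < `|v 0 m| * `|e m| * n.+1%:R.
  rewrite -{1}normrM vE normrN.
  apply: (@le_lt_trans _ _ ((\sum_i `|v 0 m| * `|A i m - (i == m)%:R * e m|) * n.+1%:R)).
    rewrite ler_wpM2r ?ler0n // (le_trans (ler_norm_sum _ _ _)) // ler_sum // => i _.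
    by rewrite normrM ler_wpM2r // mmax.
  rewrite mulr_suml (_ : _ * n.+1%:R = \sum_(i < n.+1) `|v 0 m| * `|e m|); last first.
    by rewrite sumr_const card_ord mulr_natr.
  apply: ltr_sum => [|i _]; first by apply/hasP; exists ord0; rewrite ?mem_index_enum.
  by rewrite -mulrA ltr_pM2l.
by rewrite ltxx.
Qed.

(** * Relations forced by the periodicity of rationals *)

Section RationalPeriodic.
Variables (R : realType) (p : nat) (beta : 'I_p.+1 -> R).
Hypothesis beta_gt1 : forall i, 1 < beta i.
Hypothesis rat_periodic :
  forall q : rat, 0 <= q < 1 -> eventually_periodic_exp beta (ratr q).

Local Notation delta := (\prod_(i < p.+1) beta i).
Local Notation weight := (weight beta).
Local Notation blockdigit := (blockdigit beta).

(** [block_poly] is a Horner scheme whose factor ['X] mirrors the factor [delta] gained at each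
    block. *)
Lemma altrem_block_poly x n :
  altrem beta x (n * p.+1) =
  delta ^+ n * x - \sum_(i < p.+1) weight i * ev delta (block_poly (blockdigit x i) n).
Proof.
elim: n => [|n IH].
  rewrite mul0n expr0 mul1r big1 ?subr0 // => i _.
  by rewrite /= rmorph0 mulr0.
rewrite altrem_blockS // IH exprS.
rewrite [X in _ = _ - X](_ : _ = delta *
  (\sum_(i < p.+1) weight i * ev delta (block_poly (blockdigit x i) n) +
   \sum_(i < p.+1) (blockdigit x i n)%:~R * weight i)); first by ring.
rewrite -big_split /= mulr_sumr; apply: eq_bigr => i _.
by rewrite rmorphM rmorphD /= evX evC; ring.
Qed.

(** Equates the closed forms of the equal remainders after [N] and [N + T] blocks. [M] lets [N] be
    taken large. *)
Lemma period_eq x M : 0 <= x < 1 -> eventually_periodic_exp beta x ->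
  exists N T, [/\ (M <= N)%N, (0 < T)%N &
    x * ev delta (period_den N T) =
    \sum_(i < p.+1) weight i * ev delta (period_poly (blockdigit x i) N T)].
Proof.
move=> x01 /(altrem_periodic beta_gt1 x01) [N0 [T [T0 per]]].
exists (maxn N0 M), T; split=> //; first by rewrite leq_maxr.
have := per _ (leq_maxl N0 M); rewrite !altrem_block_poly.
set d := delta => E; under eq_bigr do rewrite /period_poly rmorphB mulrBr.
by rewrite sumrB rmorphB /= !evXn; move: E; lra.
Qed.

Lemma blockdigit_right_const x n0 : exists2 eta : R, 0 < eta &
  forall y, 0 <= y < eta -> forall (i : 'I_p.+1) j, (j < n0)%N ->
    blockdigit (x + y) i j = blockdigit x i j.
Proof.
have [eta eta0 h] := altdigit_right_const beta_gt1 x (n0 * p.+1).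
exists eta => // y yb i j jn; apply: (h y yb).2.
by have := ltn_ord i; nia.
Qed.

Lemma blockdigit_weight (i m : 'I_p.+1) j :
  blockdigit (weight m) i j = ((j == 0)%N && (i == m)).
Proof.
rewrite /blockdigit altdigit_weight //; congr (nat_of_bool _)%:Z.
case: j => [|j]; first by rewrite mul0n add0n.
by apply/eqP => E; have := ltn_ord m; rewrite -E; nia.
Qed.

(** Right-constant digits let [x] share its first [n0] blocks with [weight m]. [C] is fixed first,
    so [n0] can be chosen against it. *)
Lemma rat_near_weight : exists C : nat, forall (m : 'I_p.+1) n0 (eps : R),
  (0 < n0)%N -> 0 < eps ->
  exists (x : rat) (c : 'I_p.+1 -> nat -> int) (N T : nat),
  [/\ (0 < N)%N /\ (0 < T)%N, `|ratr x - weight m| <= eps,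
      ratr x * ev delta (period_den N T) =
        \sum_(i < p.+1) weight i * ev delta (period_poly (c i) N T) &
      forall i, [/\ c i 0%N = (i == m), forall j, (0 < j < n0)%N -> c i j = 0 &
                    forall j, `|c i j| <= C%:Z]].
Proof.
have [C hC] := altdigit_bounded beta_gt1; exists C => m n0 eps n00 eps0.
have [eta eta0 heta] := blockdigit_right_const (weight m) n0.
have g0 := weight_gt0 beta_gt1 m; have g1 := weight_lt1 beta_gt1 m.
have [|x] := @rat_in_itvoo _ (weight m) (Num.min 1 (weight m + Num.min eta eps)).
  by rewrite lt_min g1 ltrDl lt_min eta0.
rewrite in_itv /= lt_min -ltrBlDl lt_min => /and4P[xg x1 xeta xeps].
have x01 : 0 <= (ratr x : R) < 1 by rewrite x1 andbT; lra.
have xq : 0 <= x < 1 by rewrite -(ler0q R) -(ltr_rat R) rmorph1.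
have [N [T [N0 T0 E]]] := period_eq 1 x01 (rat_periodic xq).
exists x, (fun i => blockdigit (ratr x) i), N, T; split=> //.
  by rewrite ger0_norm; lra.
have dE (i : 'I_p.+1) j : (j < n0)%N -> blockdigit (ratr x) i j = ((j == 0)%N && (i == m)).
  move=> jn; rewrite -blockdigit_weight -(heta (ratr x - weight m)) ?subrKC //.
  by rewrite xeta; lra.
move=> i; split=> [|j /andP[j0 jn]|j]; first by rewrite dE.
  by rewrite dE // -[j == _]negbK -lt0n j0.
exact: hC.
Qed.

(* The expansions of rationals slightly above each weight form a linear system
   in the weights whose matrix is nearly diagonal; conclude by Cramer's rule. *)
Lemma weight_rational : exists (g : {poly int}) (h : 'I_p.+1 -> {poly int}),
  ev delta g != 0 /\ forall i : 'I_p.+1, weight i * ev delta g = ev delta (h i).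
Proof.
have [C near] := rat_near_weight.
have d1 := delta_gt1 beta_gt1; have d0 : 0 < delta by lra.
have dn : `|delta| = delta by rewrite gtr0_norm.
have dd : 1 < `|delta| by rewrite dn.
pose K : R := C%:R * delta * (delta + 1).
(* [n0] makes the error of [ev_period_poly_near], times the matrix size [p.+1], smaller than the
   dominant entry. *)
have [n0 hn0] := exists_expr_gt (K * p.+1%:R / (delta - 1) ^+ 2) d1.
(* [t.1.1] is a matrix column, [t.1.2] its dominant value, [t.2] the right-hand side, all multiplied
   by the denominator of [x]. *)
have : forall m : 'I_p.+1, exists t : ('I_p.+1 -> {poly int}) * {poly int} * {poly int},
    \sum_(i < p.+1) weight i * ev delta (t.1.1 i) = ev delta t.2 /\
    forall i, `|ev delta (t.1.1 i) - (i == m)%:R * ev delta t.1.2| * p.+1%:R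
       < `|ev delta t.1.2|.
  move=> m; have [x [c [N [T [[N0 T0] _ E hc]]]]] := near m n0.+1 1 isT ltr01.
  have xE : ratr x * (denq x)%:~R = (numq x)%:~R :> R.
    by rewrite -[in RHS](ratr_int R) -[in LHS](ratr_int R (denq x)) -rmorphM /= numqE.
  have dx0 : 0 < (denq x)%:~R :> R by rewrite ltr0z denq_gt0.
  exists (fun i => (denq x)%:P * period_poly (c i) N T,
     (denq x)%:P * period_den N T, (numq x)%:P * period_den N T) => /=; split.
    rewrite rmorphM /= evC -xE mulrAC E mulr_suml; apply: eq_bigr => i _.
    by rewrite rmorphM /= evC; ring.
  move=> i; rewrite !rmorphM /= evC mulrCA -mulrBr !normrM -mulrA ltr_pM2l; last first.
    by rewrite normr_gt0 lt0r_neq0.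
  have [c0 cz cC] := hc i.
  have := ev_period_poly_near dd cC cz isT N0 T0; rewrite c0 dn -/K.
  have En := ev_period_den_neq0 dd N T0.
  set V := `|_ - _|; set E' := `|_| => VE.
  have E0 : 0 < E' by rewrite normr_gt0.
  have q0 : 0 < (delta - 1) ^+ 2 by rewrite exprn_gt0 // subr_gt0.
  have n1 : K * p.+1%:R < (delta - 1) ^+ 2 * delta ^+ n0.+1.
    move: hn0; rewrite ltr_pdivrMr // [ltRHS]mulrC => /lt_trans; apply.
    by rewrite ltr_pM2l // ltr_eXn2l.
  have P0 : 0 < p.+1%:R :> R by rewrite ltr0n.
  have Q0 : 0 < (delta - 1) ^+ 2 * delta ^+ n0.+1 by rewrite mulr_gt0 // exprn_gt0.
  rewrite -(ltr_pM2r Q0) mulrAC (le_lt_trans (ler_wpM2r (ltW P0) VE)) //.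
  by rewrite mulrAC mulrC ltr_pM2l.
move=> /choice [t ht].
pose A := \matrix_(i, m < p.+1) (t m).1.1 i.
pose A' := map_mx (ev delta) A.
have detA : ev delta (\det A) != 0.
  rewrite -det_map_mx; apply: (@det_neq0_diag_dominant _ _ _ (fun m => ev delta (t m).1.2)).
  by move=> i m; rewrite !mxE; apply: (ht m).2.
pose r := \row_m (t m).2.
exists (\det A), (fun i => (r *m \adj A) 0 i); split=> // i.
have gA : (\row_i weight (i : 'I_p.+1)) *m A' = map_mx (ev delta) r.
  apply/rowP => m; rewrite !mxE -(ht m).1; apply: eq_bigr => j _.
  by rewrite !mxE.
have /rowP/(_ i) : (\row_i weight (i : 'I_p.+1)) *m (A' *m \adj A') =
   map_mx (ev delta) (r *m \adj A) by rewrite mulmxA gA map_mxM map_mx_adj.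
by rewrite mul_mx_adj mul_mx_scalar det_map_mx !mxE mulrC.
Qed.

(* Obtained from the expansion of [1 / (D k)] with [k] so large that its first
   [e + 1] blocks vanish. *)
Lemma monic_relation (D e : nat) : (0 < D)%N ->
  exists (M : {poly int}) (V : 'I_p.+1 -> {poly int}),
  [/\ M \is monic, forall i, (size (V i) + e < size M)%N &
      ev delta M = D%:R * \sum_(i < p.+1) weight i * ev delta (V i)].
Proof.
move=> D0; have [eta eta0 heta] := blockdigit_right_const 0 e.+1.
(* The bound puts [x] below [eta]; adding 2 makes [D * k] exceed 1. *)
pose k := (Num.bound eta^-1).+2; pose x : rat := (D * k)%:R^-1.
have Dk : (1 < D * k)%N by rewrite /k; nia.
have xE : ratr x = (D * k)%:R^-1 :> R by rewrite /x fmorphV rmorph_nat.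
have Dk0 : 0 < (D * k)%:R :> R by rewrite ltr0n ltnW.
have x0 : 0 <= (ratr x : R) by rewrite xE invr_ge0 ltW.
have x01 : 0 <= (ratr x : R) < 1 by rewrite x0 xE invf_lt1 // ltr1n.
have xeta : 0 <= (ratr x : R) < eta.
  rewrite x0 xE invf_plt ?posrE //; apply: lt_le_trans (archi_boundP _) _.
    by rewrite invr_ge0 ltW.
  have kb : (Num.bound eta^-1 <= k)%N by apply/leqW/leqW.
  by rewrite ler_nat (leq_trans kb) // leq_pmull.
have xq : 0 <= x < 1 by rewrite -(ler0q R) -(ltr_rat R) rmorph1.
(* [N > e] makes the truncated subtraction in [size_period_poly] exact. *)
have [N [T [N0 T0 E]]] := period_eq e.+1 x01 (rat_periodic xq).
have sM : size (period_den N T) = (N + T).+1.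
  rewrite size_polyDl ?size_polyXn // size_polyN size_polyXn.
  by rewrite ltnS -[X in (X < _)%N]addn0 ltn_add2l.
exists (period_den N T), (fun i => (k%:Z)%:P * period_poly (blockdigit (ratr x) i) N T).
split.
- rewrite monicE lead_coefDl ?lead_coefXn // size_polyN !size_polyXn.
  by rewrite ltnS -[X in (X < _)%N]addn0 ltn_add2l.
- move=> i; rewrite sM mul_polyC.
  have c0 j : (j < e.+1)%N -> blockdigit (ratr x) i j = 0.
    by move=> je; rewrite -[ratr x]add0r heta //; apply: altdigit0.
  have := size_scale_leq k%:Z (period_poly (blockdigit (ratr x) i) N T).
  have := size_period_poly N T c0.
  by move: (size _) (size _) => a b; lia.
set d := delta in E *; set s := \sum_(i < _) _.
have -> : s = k%:R * \sum_(i < p.+1) weight i * ev d (period_poly (blockdigit (ratr x) i) N T).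
  rewrite mulr_sumr; apply: eq_bigr => i _; rewrite rmorphM /= evC; ring.
rewrite -E xE !mulrA -natrM mulfV ?mul1r // lt0r_neq0 //.
Qed.

(** * Integrality of [delta] and the field of the bases *)

Lemma delta_algebraic : exists q : {poly int}, q != 0 /\ ev delta q = 0.
Proof.
have [g [h [g0 gh]]] := weight_rational.
pose e := (\max_i size (h i))%N.
have he i : (size (h i) <= e)%N by exact: (leq_bigmax i).
have [M [V [Mm sV E]]] := @monic_relation 1 e isT.
(* Multiplying by [g] turns weights into the [h i]; the small sizes of the [V i] keep the top term
   of [g * M] alive. *)
exists (g * M - \sum_i h i * V i); split.
  have gn0 : g != 0 by apply: contraNneq g0 => ->; rewrite rmorph0.
  rewrite subr_eq0; apply: contraTneq (size_sum_mul_lt sV he) => <-.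
  rewrite -leqNgt size_Mmonic // -[leqLHS]add0n -subn1 leq_subRL ?addn_gt0 ?lt0n ?size_poly_eq0 ?gn0 //.
  by rewrite addnA leq_add2r addn0 lt0n size_poly_eq0.
rewrite rmorphB rmorphM rmorph_sum /= E mul1r mulr_sumr; apply/eqP.
rewrite subr_eq0; apply/eqP; apply: eq_bigr => i _.
by rewrite rmorphM /= -gh; ring.
Qed.

(* Discarding from an annihilator of [delta] its common factors with the
   denominator [g] makes [g] invertible by Bezout. *)
Lemma weight_polynomial : exists (D : nat) (h : 'I_p.+1 -> {poly int}),
  (0 < D)%N /\ forall i : 'I_p.+1, D%:R * weight i = ev delta (h i).
Proof.
have [g [h [g0 gh]]] := weight_rational; have [q [q0 qd]] := delta_algebraic.
set d := delta in g0 gh qd *.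
pose Q := map_poly intr q : {poly rat}; pose G := map_poly intr g : {poly rat}.
have Q0 : Q != 0.
  rewrite map_poly_eq0_id0 // intr_eq0; by rewrite lead_coef_eq0.
have Gd : (map_poly ratr G).[d] = ev d g by exact: ev_map_ratr.
have /Bezout_eq1_coprimepP [[u v] /= uv] := coprimep_gdco G Q0.
have rd : (map_poly ratr (gdcop G Q)).[d] = 0.
  apply/eqP; rewrite -[_ == 0]/(root _ _) gdcop_map root_gdco ?map_poly_eq0 //.
  by rewrite /root Gd g0 andbT ev_map_ratr qd.
have vg : (map_poly ratr v).[d] * ev d g = 1.
  have := congr1 (fun r => (map_poly ratr r).[d]) uv.
  by rewrite rmorphD !rmorphM /= !hornerE rd Gd mulr0 add0r rmorph1 hornerC.
have [w [a a0 vE]] : exists w, exists2 a : int, a != 0 & v = a%:~R^-1 *: map_poly intr w.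
  by have [w [a]] := rat_poly_scale v; exists w, a.
have wg : ev d w * ev d g = a%:~R.
  have an0 : a%:~R != 0 :> R by rewrite intr_eq0.
  move: vg; rewrite vE map_polyZ /= hornerZ ev_map_ratr fmorphV /= ratr_int.
  by move=> /(congr1 (fun t => a%:~R * t)); rewrite !mulrA mulfV // mul1r mulr1.
have aa : (absz (a * a))%:R = a%:~R * a%:~R :> R.
  rewrite -intrM -[RHS]/((a * a)%:~R) -[X in X%:~R]gez0_abs //.
  by rewrite -expr2 sqr_ge0.
(* [a] may be negative, so the denominator is [a * a], whence the extra factor [a] in the
   numerators. *)
exists (absz (a * a)), (fun i => a%:P * (w * h i)); split.
  by rewrite absz_gt0 mulf_neq0.
by move=> i; rewrite aa !rmorphM /= evC -gh -wg; ring.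
Qed.

(** The factor [D] of the monic relation absorbs the common denominator of the weights, leaving the
    leading coefficient of [M] untouched. *)
Lemma delta_alg_int : alg_int delta.
Proof.
have [D [h [D0 Dh]]] := weight_polynomial.
pose e := (\max_i size (h i))%N.
have he i : (size (h i) <= e)%N by exact: (leq_bigmax i).
have [M [V [Mm sV E]]] := monic_relation e D0.
have sz := size_sum_mul_lt sV he.
exists (M - \sum_i h i * V i); split.
  by rewrite monicE lead_coefDl ?size_polyN // -monicE.
change (ev delta (M - \sum_i h i * V i) == 0).
rewrite rmorphB rmorph_sum /= E mulr_sumr subr_eq0; apply/eqP.
by apply: eq_bigr => i _; rewrite rmorphM /= -Dh; ring.
Qed.

(** [beta i] is a ratio of consecutive base products, so [D] cancels; for [i = 0] the earlier
    product is 1 and [D] stays. *)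
Lemma beta_in_Qfield i : in_Qfield delta (beta i).
Proof.
have [D [h [D0 Dh]]] := weight_polynomial.
have Dn0 : 0 < D%:R :> R by rewrite ltr0n.
have hp (j : 'I_p.+1) : 0 < ev delta (h j) by rewrite -Dh mulr_gt0 ?weight_gt0.
have bE : betak beta i.+1 = beta i.
  by rewrite /betak /= modn_small // inord_val.
have gp (j : 'I_p.+1) : base_prod beta j.+1 = D%:R / ev delta (h j).
  by rewrite -Dh /weight invfM mulrA mulfV ?lt0r_neq0 // mul1r invrK.
have := base_prodS beta i; rewrite bE gp => E.
case: (posnP i) => i0.
  exists (map_poly intr D%:Z%:P), (map_poly intr (h i)).
  rewrite !ev_map_ratr evC lt0r_neq0 //; split=> //.
  by rewrite E i0 base_prod0 mulr1.
have ip : (i.-1 < p.+1)%N by rewrite prednK // ltnW.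
pose j := Ordinal ip.
exists (map_poly intr (h j)), (map_poly intr (h i)).
rewrite !ev_map_ratr lt0r_neq0 //; split=> //.
move: E; rewrite -[in RHS](prednK i0) (gp j) => E.
have := hp i; have := hp j => /lt0r_neq0 hj /lt0r_neq0 hi.
apply: (mulIf (x := D%:R / ev delta (h j))).
  by rewrite mulf_neq0 ?invr_neq0 // lt0r_neq0.
by rewrite -E; field; rewrite hi hj.
Qed.

(* Rationals tending to [1 / delta] also tend to [1 / z] when [1 < |z|]. *)
Lemma conjugate_norm_le1 (z : R[i]) :
  conjugate delta z -> z != (delta%:C)%C -> `|z| <= 1.
Proof.
move=> cz zd; rewrite real_leNgt ?normr_real ?real1 //; apply/negP => z1.
have d1 := delta_gt1 beta_gt1; have dn0 : delta != 0 by apply/lt0r_neq0; lra.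
have zn0 : z != 0 by rewrite -normr_gt0 (lt_trans ltr01).
(* Moduli in [R[i]] are complex; they are pulled back to [R], where the growth lemma applies. *)
have normE (w : R[i]) : exists2 r : R, 0 <= r & `|w| = (r%:C)%C.
  by exists (complex.Re `|w|); rewrite normc_def //= sqrtr_ge0.
have [D [h [D0 Dh]]] := weight_polynomial; have [C near] := rat_near_weight.
have [t t0 tE] := normE z; have t1 : 1 < t by rewrite tE ltcR in z1.
have D0C : D%:R != 0 :> R[i] by rewrite pnatr_eq0 -lt0n.
have [s s0 sE] : exists2 s : R, 0 <= s & \sum_(i < p.+1) `|ev z (h i)| = (s%:C)%C.
  exists (complex.Re (\sum_(i < p.+1) `|ev z (h i)|)).
    suff : 0 <= \sum_(i < p.+1) `|ev z (h i)| by case: (\sum_(i < p.+1) _) => a b /andP[].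
    by apply: sumr_ge0.
  by rewrite RRe_real // ger0_real // sumr_ge0.
(* The last weight is [1 / delta]; as a polynomial identity this carries over to [z]. *)
have hm : ev z (h ord_max) = D%:R / z.
  have : ev z (h ord_max * 'X - D%:Z%:P) = 0.
    apply: (conjugate_ev0 cz); rewrite rmorphB rmorphM /= evX evC -Dh.
    by rewrite /weight base_prod_period // mulfVK // subrr.
  rewrite rmorphB rmorphM /= evX evC => /eqP; rewrite subr_eq0 => /eqP hz.
  by rewrite -[D%:R]/(D%:Z%:~R) -hz mulfK.
have [k k0 kE] := normE (D%:R * ((delta%:C)%C^-1 - z^-1)).
pose K := s * (C%:R * t * (t + 1)) + D%:R * (t - 1) ^+ 2.
(* A bound for all [n] forces [k], the modulus of [D (1/delta - 1/z)], to vanish. *)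
have bound n : k * (t - 1) ^+ 2 * t * t ^+ n <= K.
  rewrite -mulrA -exprS; set n0 := n.+1.
  have tn0 : 0 < t ^+ n0 by rewrite exprn_gt0 // (lt_trans ltr01).
  have tn0V : 0 < t ^- n0 by rewrite invr_gt0.
  have [x [c [N [T [[N0 T0] xm E hc]]]]] := near ord_max n0 (t ^- n0) isT tn0V.
  have xE (F : numFieldType) : ratr x * (denq x)%:~R = (numq x)%:~R :> F.
    by rewrite -[in RHS](ratr_int F) -[in LHS](ratr_int F (denq x)) -rmorphM /= numqE.
  have dx0 (F : numFieldType) : (denq x)%:~R != 0 :> F by rewrite intr_eq0 denq_neq0.
  (* Cleared of denominators, the relation for [x] is an integer polynomial identity at [delta],
     hence at [z]. *)
  have Ez : D%:R * ratr x * ev z (period_den N T) =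
      \sum_(i < p.+1) ev z (h i) * ev z (period_poly (c i) N T).
    have : ev z (D%:Z%:P * (numq x)%:P * period_den N T -
       (denq x)%:P * \sum_(i < p.+1) h i * period_poly (c i) N T) = 0.
      apply: (conjugate_ev0 cz); apply/eqP; move: E; set d := delta => E.
      rewrite rmorphB !rmorphM rmorph_sum /= !evC subr_eq0; apply/eqP.
      rewrite -(xE R) [LHS](_ : _ = (denq x)%:~R * (D%:R * (ratr x * ev d (period_den N T)))); last by ring.
      rewrite E mulr_sumr; congr (_ * _); apply: eq_bigr => i _.
      by rewrite rmorphM /= -Dh mulrA.
    rewrite rmorphB !rmorphM rmorph_sum /= !evC => /eqP; rewrite subr_eq0 -(xE R[i]) => /eqP zE.
    apply: (mulfI (dx0 R[i])); rewrite [LHS](_ : _ =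
      D%:~R * (ratr x * (denq x)%:~R) * ev z (period_den N T)); last by ring.
    by rewrite zE; congr (_ * _); apply: eq_bigr => i _; rewrite rmorphM.
  have En0 := ev_period_den_neq0 z1 N T0.
  set e := ev z (period_den N T) in Ez En0.
  pose Q := (`|z| - 1) ^+ 2 * `|z| ^+ n0.
  have z10 : 0 < `|z| - 1 by rewrite subr_gt0.
  have Q0 : 0 <= Q by rewrite mulr_ge0 ?exprn_ge0 // ltW.
  (* Only the series of index [ord_max] starts with 1, so at [z] the relation puts [x] near
     [1 / z]. *)
  have near1 : `|D%:R * ratr x - D%:R / z| * Q <= (s%:C)%C * (C%:R * `|z| * (`|z| + 1)).
    rewrite -(@ler_pM2r _ `|e|) ?normr_gt0 // mulrAC -normrM mulrBl Ez -hm.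
    have -> : ev z (h ord_max) * e = \sum_(i < p.+1) ev z (h i) * ((c i 0%N)%:~R * e).
      rewrite (bigD1 ord_max) //= big1 => [|i /negPf im].
        by have [-> _ _] := hc ord_max; rewrite eqxx mul1r addr0.
      by have [-> _ _] := hc i; rewrite im mul0r mulr0.
    rewrite -sumrB -sE !mulr_suml.
    apply: (@le_trans _ _ ((\sum_(i < p.+1) `|ev z (h i)| *
       `|ev z (period_poly (c i) N T) - (c i 0%N)%:~R * e|) * Q)).
      rewrite ler_wpM2r // (le_trans (ler_norm_sum _ _ _)) // ler_sum // => i _.
      by rewrite -mulrBr normrM.
    rewrite mulr_suml ler_sum // => i _; rewrite -mulrA -[leRHS]mulrA ler_wpM2l //.
    by have [_ cz0 cC] := hc i; apply: ev_period_poly_near.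
  (* The tolerance [t ^- n0] cancels the factor [|z|^n0] of [Q]. *)
  have near2 : `|D%:R * ((delta%:C)%C^-1 - ratr x)| * Q <= D%:R * (`|z| - 1) ^+ 2.
    rewrite normrM [`|D%:R|]ger0_norm ?ler0n // -mulrA ler_wpM2l ?ler0n //.
    rewrite /Q mulrCA ler_piMr ?exprn_ge0 ?(ltW z10) // tE -(fmorph_rat (@real_complex R)).
    rewrite -fmorphV -rmorphB /= normc_def /= expr0n /= addr0 sqrtr_sqr -rmorphXn -rmorphM /=.
    rewrite -(rmorph1 (@real_complex R)) lecR.
    rewrite distrC; move: xm; rewrite /weight base_prod_period // => xm.
    by rewrite -ler_pdivlMr // div1r.
  have : `|D%:R * ((delta%:C)%C^-1 - z^-1)| * Q <=
      (s%:C)%C * (C%:R * `|z| * (`|z| + 1)) + D%:R * (`|z| - 1) ^+ 2.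
    apply: le_trans (lerD near1 near2); rewrite -mulrDl ler_wpM2r //.
    rewrite addrC (le_trans _ (ler_normD _ _)) // le_eqVlt; apply/orP; left; apply/eqP.
    by congr `|_|; ring.
  rewrite kE /Q tE -(rmorph1 (@real_complex R)) -!(rmorph_nat (@real_complex R)).
  rewrite -rmorphB -rmorphD -!rmorphXn -!rmorphM -rmorphD /= lecR.
  by rewrite mulrA.
have tp : 0 < t - 1 by rewrite subr_gt0.
have a0 : 0 <= k * (t - 1) ^+ 2 * t by rewrite mulr_ge0 // mulr_ge0 // sqr_ge0.
have /eqP := expr_mul_bounded_eq0 t1 a0 bound.
rewrite !mulf_eq0 (gt_eqF tp) (gt_eqF (lt_trans ltr01 t1)) !orbF.
move=> /eqP kz; move/eqP: kE; rewrite kz normr_eq0 mulf_eq0 (negPf D0C) /= subr_eq0.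
by move=> /eqP /invr_inj E; rewrite E eqxx in zd.
Qed.

End RationalPeriodic.

(* alternate base of length p.+1 (p.+1 >= 1), given as beta : 'I_p.+1 -> R *)
Theorem theoremA (R : realType) (p : nat) (beta : 'I_p.+1 -> R) :
  (forall i, 1 < beta i) ->
  (forall q : rat, 0 <= q < 1 -> eventually_periodic_exp beta (ratr q)) ->
  (pisot (\prod_(i < p.+1) beta i) \/ salem (\prod_(i < p.+1) beta i)) /\
  (forall i, in_Qfield (\prod_(j < p.+1) beta j) (beta i)).
Proof.
move=> beta1 per; split; last exact: beta_in_Qfield.
have int := delta_alg_int beta1 per; have d1 := delta_gt1 beta1.
have le1 := @conjugate_norm_le1 _ _ _ beta1 per.
set d := \prod_(i < p.+1) beta i in int d1 le1 *.
(* Another conjugate of modulus 1 separates Salem from Pisot. *)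
case: (pselect (exists2 z : R[i], conjugate d z /\ z != (d%:C)%C & `|z| = 1)) => [ex|nex].
  by right; split.
left; split=> // z cz zd; rewrite lt_neqAle le1 // andbT; apply/eqP => z1.
by case: nex; exists z.
Qed.
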